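(* Let $r\ge 1$ be an integer. (a) For every real $s>0$, $$\frac1{\beta(s)^r}=\sum_{n=0}^{\infty}\frac{b_{s,r,n}}{2^n},$$ where $(b_{s,r,n})_{n\ge0}$ is given by $b_{s,r,0}=1$ and $b_{s,r,n}=\frac1n\sum_{k=1}^{n}[n+(r-1)k]\,q_{s,k}\,b_{s,r,n-k}$ for $n\ge1$. (b) For every real $s\ge 2$, $$\frac1{\beta(s)^r}=\sum_{n=0}^{\infty}\frac{c_{s,r,n}}{3^n},$$ where $(c_{s,r,n})_{n\ge0}$ is given by $c_{s,r,0}=1$ and $c_{s,r,n}=\frac1n\sum_{k=1}^{n}[n+(r-1)k]\,p_{s,k}\,c_{s,r,n-k}$ for $n\ge1$. All the coefficients $b_{s,r,n}$ (for $s>0$) and $c_{s,r,n}$ (for $s\ge2$), $n\ge0$, are strictly positive. If $s$ is an integer, they are rational.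
   Context: For real $s>0$, $\beta(s)=\sum_{k=0}^{\infty}\frac{(-1)^k}{(2k+1)^s}$ is the Dirichlet beta function. For real $s>0$ and integers $n\ge1$, $$q_{s,n}=\sum_{k=1}^{n}\frac{(-1)^{k+1}}{(2k+1)^s}\binom{n-1}{k-1},\qquad p_{s,n}=\sum_{k=1}^{n}\frac{(-1)^{k+1}2^k}{(2k+1)^s}\binom{n-1}{k-1}.$$ *)

(* Defs.v *)
From Stdlib Require Export Reals Qreals.
From Stdlib Require Import Lra Lia List.
From Coquelicot Require Export Coquelicot.
Open Scope R_scope.

(** The Dirichlet beta function, for real [s > 0].  [Series] is a total
    operator; [beta_correct] shows that for [s > 0] the series converges to
    [beta s], and [beta_pos] that [1 / beta s ^ r] is a genuine quotient. *)
Definition beta_term (s : R) (k : nat) : R :=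
  (-1) ^ k / Rpower (2 * INR k + 1) s.

Definition beta (s : R) : R := Series (beta_term s).

(* [Binomial.C] is qualified because Coquelicot's [C] is the complex field. *)
Definition q (s : R) (n : nat) : R :=
  sum_n_m (fun k => (-1) ^ (k + 1) / Rpower (2 * INR k + 1) s
                    * Binomial.C (n - 1) (k - 1)) 1 n.

Definition p (s : R) (n : nat) : R :=
  sum_n_m (fun k => (-1) ^ (k + 1) * 2 ^ k / Rpower (2 * INR k + 1) s
                    * Binomial.C (n - 1) (k - 1)) 1 n.

(** [rec_seq r a] is the sequence [u] with [u 0 = 1] and, for [n >= 1],
    [u n = 1/n * sum_(k=1)^n [n + (r-1) k] * a k * u (n-k)]
    (lemmas [rec_seq_0] and [rec_seq_rec]).  As every earlier term is needed,
    the recursion carries the list [u n; u (n-1); ...; u 0]. *)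
Fixpoint rec_list (r : nat) (a : nat -> R) (n : nat) : list R :=
  match n with
  | O => 1 :: nil
  | S m =>
      let l := rec_list r a m in
      (1 / INR n * sum_n_m (fun k => (INR n + (INR r - 1) * INR k) * a k
                                     * nth (k - 1) l 0) 1 n) :: l
  end.

Definition rec_seq (r : nat) (a : nat -> R) (n : nat) : R :=
  hd 0 (rec_list r a n).

Definition b (s : R) (r n : nat) : R := rec_seq r (q s) n.
Definition c (s : R) (r n : nat) : R := rec_seq r (p s) n.

Definition is_integer (x : R) : Prop := exists z : Z, x = IZR z.
Definition is_rational (x : R) : Prop := exists y : Q, x = Q2R y.

Lemma rec_seq_0 (r : nat) (a : nat -> R) : rec_seq r a 0 = 1.
Proof. reflexivity. Qed.

Lemma nth_rec_list (r : nat) (a : nat -> R) (n j : nat) :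
  (j <= n)%nat -> nth j (rec_list r a n) 0 = rec_seq r a (n - j).
Proof.
revert j; induction n as [|n IH]; intros [|j] Hj; try reflexivity; [lia|].
exact (IH j ltac:(lia)).
Qed.

Lemma rec_seq_rec (r : nat) (a : nat -> R) (n : nat) :
  (1 <= n)%nat ->
  rec_seq r a n =
  1 / INR n * sum_n_m (fun k => (INR n + (INR r - 1) * INR k) * a k
                                * rec_seq r a (n - k)) 1 n.
Proof.
intros Hn; destruct n as [|m]; [lia|].
unfold rec_seq at 1; cbn [rec_list hd].
f_equal; apply sum_n_m_ext_loc; intros k Hk.
rewrite nth_rec_list by lia.
now replace (m - (k - 1))%nat with (S m - k)%nat by lia.
Qed.

Lemma beta_aux (s : R) :
  0 < s -> is_series (beta_term s) (beta s) /\ 0 < beta s.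
Proof.
intros Hs.
set (u := fun k : nat => / Rpower (2 * INR k + 1) s).
assert (Hdec : Un_decreasing u).
{ intros n; unfold u; apply Rinv_le_contravar.
  - apply exp_pos.
  - rewrite S_INR; pose proof (pos_INR n).
    apply Rle_Rpower_l; lra. }
assert (Hlim : Un_cv u 0).
{ apply is_lim_seq_Reals.
  apply is_lim_seq_ext with (fun n => exp (- (s * ln (2 * INR n + 1)))).
  { intros n; unfold u, Rpower; apply exp_Ropp. }
  apply (is_lim_comp_seq exp _ m_infty (Finite 0)).
  - exact is_lim_exp_m.
  - exists 0%nat; intros; discriminate.
  - change m_infty with (Rbar_opp p_infty); apply -> is_lim_seq_opp.
    replace p_infty with (Rbar_mult s p_infty).
    2:{ simpl; destruct (Rle_dec 0 s) as [H|H]; [|lra].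
        destruct (Rle_lt_or_eq_dec 0 s H); [reflexivity|lra]. }
    apply is_lim_seq_scal_l.
    apply (is_lim_comp_seq ln _ p_infty p_infty).
    + exact is_lim_ln_p.
    + exists 0%nat; intros; discriminate.
    + apply is_lim_seq_le_p_loc with INR; [|exact is_lim_seq_INR].
      exists 0%nat; intros n _; pose proof (pos_INR n); lra. }
destruct (alternated_series u Hdec Hlim) as [l Hl].
assert (Hser : is_series (beta_term s) l).
{ apply is_series_Reals.
  intros eps He; destruct (Hl eps He) as [N HN]; exists N; intros n Hn.
  exact (HN n Hn). }
assert (Hb : beta s = l) by (apply is_series_unique; exact Hser).
rewrite Hb; split; [exact Hser|].
destruct (alternated_series_ineq u l 0 Hdec Hlim Hl) as [Hlow _].
apply Rlt_le_trans with (2 := Hlow).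
unfold tg_alt, u; simpl.
replace (2 * 0 + 1) with 1 by ring; replace (2 * 1 + 1) with 3 by ring.
assert (H1 : Rpower 1 s = 1) by (unfold Rpower; rewrite ln_1, Rmult_0_r; apply exp_0).
rewrite H1.
assert (H3 : 1 < Rpower 3 s).
{ rewrite <- (Rpower_O 3) by lra; apply Rpower_lt; lra. }
assert (/ Rpower 3 s < 1) by (rewrite <- Rinv_1; apply Rinv_lt_contravar; lra).
lra.
Qed.

Lemma beta_correct (s : R) : 0 < s -> is_series (beta_term s) (beta s).
Proof. intros Hs; apply (beta_aux s Hs). Qed.

Lemma beta_pos (s : R) : 0 < s -> 0 < beta s.
Proof. intros Hs; apply (beta_aux s Hs). Qed.

(* Main.v *)
Require Import Defs.
From Stdlib Require Import Reals.
From Stdlib Require Import Qreals Arith ZArith Lra Lia.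
From Coquelicot Require Import Coquelicot.
Open Scope R_scope.

(** Write [a_k = (2k+3)^(-s)], let [T] be the shift of sequences, and let [l] be
    [1] for the first expansion and [2] for the second.  Then [q_(n+1)]
    ([l = 1]) and [p_(n+1)] ([l = 2]) are [l ((1 - l T)^n a)_0]
    ([q_diff], [p_diff]), and [1 - beta(s)] is the alternating sum of [a].

    Expansions.  The Euler transformation with parameter [l]
    ([euler_transform]) rewrites this alternating sum as
    [sum_n l ((1 - l T)^n a)_0 / (1 + l)^(n+1)].  Its remainder tends to [0]
    because [a] is completely monotone and [|1 - l| <= 1]
    ([Rabs_Series_alt_diff_le]).  So if [A(x) = sum_n A_n x^n] has the
    coefficients [A_n = q_n] or [A_n = p_n], then
    [1 - A(1/(1+l)) = beta(s)].  The recursion is the differential equation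
    [(1 - A) x U' = r x A' U] read on coefficients, so it produces the
    coefficients of [U = (1 - A)^(-r)].  On sequences this becomes: the solutions
    for [r] and [r'] have the solution for [r + r'] as their Cauchy product
    ([rec_seq_conv]), which reduces the summation to [r = 1], a renewal equation
    with nonnegative coefficients ([is_series_rec_seq]).

    Positivity.  The recursion has nonnegative weights, so it is enough that all
    [q_n], [p_n] are nonnegative and the first is positive.  For [q] this is the
    complete monotonicity of [t^(-s)], obtained from the mean value theorem by
    induction on the order of the difference ([diff_Rpower_pos]).  For [p] the
    sequence [((1 - 2 T)^m a)_0] is, up to the factor [Gamma(s)], the integral
    of [e^(-3v) (1 - 2 e^(-2v))^m v^(s-1)] over the half-line.  The integrand
    is nonnegative for even [m].  For odd [m] it changes sign once, from minus
    to plus, at [v0 = (ln 2)/2], so that replacing [v^(s-1)] by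
    [v0^(s-2) v] can only decrease it: this is a reduction to [s = 2]
    ([diff_odd_power_compare]).  There the substitution [x = e^(-v)] gives
    the integral of [x^2 (- ln x) (1 - 2 x^2)^m] over [[0, 1]], in which the
    contribution of [x = sin t] dominates that of [x = cos t] for
    [t <= pi/4] ([diff_odd_power_2_nonneg]).

    Rationality is immediate from the recursion. *)

(** * Cauchy products and the recursion *)

Definition conv (f g : nat -> R) (n : nat) : R :=
  sum_n (fun k => f k * g (n - k)%nat) n.

Lemma sum_n_S_left (f : nat -> R) (n : nat) :
  sum_n f (S n) = f 0%nat + sum_n (fun k => f (S k)) n.
Proof.
unfold sum_n; rewrite sum_Sn_m by lia.
now rewrite sum_n_m_S.
Qed.

Lemma sum_n_S_right (f : nat -> R) (n : nat) :
  sum_n f (S n) = sum_n f n + f (S n).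
Proof. exact (sum_Sn f n). Qed.

Lemma sum_n_congr (f g : nat -> R) (n : nat) :
  (forall k, (k <= n)%nat -> f k = g k) -> sum_n f n = sum_n g n.
Proof. exact (sum_n_ext_loc f g n). Qed.

Lemma sum_n_add (f g : nat -> R) (n : nat) :
  sum_n (fun k => f k + g k) n = sum_n f n + sum_n g n.
Proof. exact (sum_n_plus f g n). Qed.

Lemma sum_n_scal (l : R) (f : nat -> R) (n : nat) :
  sum_n (fun k => l * f k) n = l * sum_n f n.
Proof. exact (sum_n_mult_l (K := R_Ring) l f n). Qed.

Lemma sum_n_le (f g : nat -> R) (n : nat) :
  (forall k, (k <= n)%nat -> f k <= g k) -> sum_n f n <= sum_n g n.
Proof. intros H; rewrite !sum_n_Reals; now apply sum_Rle. Qed.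

Lemma sum_n_nonneg (f : nat -> R) (n : nat) :
  (forall k, (k <= n)%nat -> 0 <= f k) -> 0 <= sum_n f n.
Proof.
induction n as [|n IH]; intros H.
- rewrite sum_O; now apply H.
- rewrite sum_n_S_right; apply Rplus_le_le_0_compat; [apply IH; auto|now apply H].
Qed.

Lemma conv_0 (f g : nat -> R) : conv f g 0 = f 0%nat * g 0%nat.
Proof. unfold conv; now rewrite sum_O. Qed.

Lemma conv_S (f g : nat -> R) (n : nat) :
  conv f g (S n) = f 0%nat * g (S n) + conv (fun k => f (S k)) g n.
Proof. unfold conv; now rewrite sum_n_S_left. Qed.

Lemma conv_S_right (f g : nat -> R) (n : nat) :
  conv f g (S n) = conv f (fun k => g (S k)) n + f (S n) * g 0%nat.
Proof.
unfold conv; rewrite sum_n_S_right.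
replace (S n - S n)%nat with 0%nat by lia; f_equal.
apply sum_n_congr; intros k Hk.
now replace (S n - k)%nat with (S (n - k)) by lia.
Qed.

Lemma conv_comm (f g : nat -> R) (n : nat) : conv f g n = conv g f n.
Proof.
revert f; induction n as [|n IH]; intros f.
- rewrite !conv_0; ring.
- rewrite conv_S, conv_S_right, IH; ring.
Qed.

Lemma conv_ext (f f' g g' : nat -> R) (n : nat) :
  (forall k, f k = f' k) -> (forall k, g k = g' k) ->
  conv f g n = conv f' g' n.
Proof. intros Hf Hg; apply sum_n_congr; intros k _; now rewrite Hf, Hg. Qed.

Lemma conv_plus_l (f f' g : nat -> R) (n : nat) :
  conv (fun k => f k + f' k) g n = conv f g n + conv f' g n.
Proof.
unfold conv; rewrite <- sum_n_add.
apply sum_n_congr; intros k _; ring.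
Qed.

Lemma conv_scal_l (l : R) (f g : nat -> R) (n : nat) :
  conv (fun k => l * f k) g n = l * conv f g n.
Proof.
unfold conv; rewrite <- sum_n_scal.
apply sum_n_congr; intros k _; ring.
Qed.

Lemma conv_plus_r (f g g' : nat -> R) (n : nat) :
  conv f (fun k => g k + g' k) n = conv f g n + conv f g' n.
Proof. now rewrite conv_comm, conv_plus_l, !(conv_comm f). Qed.

Lemma conv_scal_r (l : R) (f g : nat -> R) (n : nat) :
  conv f (fun k => l * g k) n = l * conv f g n.
Proof. now rewrite conv_comm, conv_scal_l, (conv_comm f). Qed.

Lemma conv_assoc (f g h : nat -> R) (n : nat) :
  conv f (conv g h) n = conv (conv f g) h n.
Proof.
revert f; induction n as [|n IH]; intros f.
- rewrite !conv_0; ring.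
- rewrite (conv_S f), (conv_S (conv f g)), IH, conv_0, (conv_S g).
  rewrite (conv_ext (fun k => conv f g (S k))
     (fun k => f 0%nat * g (S k) + conv (fun i => f (S i)) g k) h h);
    [|intros k; apply conv_S|reflexivity].
  rewrite conv_plus_l, conv_scal_l; ring.
Qed.

(** Multiplication by the index is the derivation [x d/dx] on coefficient
    sequences. *)
Definition theta (f : nat -> R) (n : nat) : R := INR n * f n.

Lemma theta_conv (f g : nat -> R) (n : nat) :
  theta (conv f g) n = conv (theta f) g n + conv f (theta g) n.
Proof.
unfold theta at 1, conv.
rewrite <- sum_n_scal, <- sum_n_add.
apply sum_n_congr; intros k Hk; unfold theta.
rewrite (minus_INR n k) by lia; ring.
Qed.

(** The recursion says that [U = sum u_n x^n] solves
    [(1 - A) x U' = r x A' U], the equation of [(1 - A)^(-r)]. *)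
Lemma rec_seq_ode (r : nat) (a : nat -> R) (n : nat) :
  a 0%nat = 0 ->
  theta (rec_seq r a) n =
  conv a (theta (rec_seq r a)) n + INR r * conv (theta a) (rec_seq r a) n.
Proof.
intros Ha.
destruct n as [|m].
{ rewrite !conv_0; unfold theta; simpl; rewrite Ha; ring. }
unfold theta at 1; rewrite rec_seq_rec by lia.
set (v := rec_seq r a).
rewrite <- (Rmult_assoc (INR (S m))).
replace (INR (S m) * (1 / INR (S m))) with 1
  by (field; apply not_0_INR; lia).
unfold conv; rewrite <- sum_n_scal, <- sum_n_add, Rmult_1_l.
rewrite sum_n_S_left; unfold sum_n at 1; rewrite <- sum_n_m_S.
match goal with |- ?x = ?y + ?z => replace y with 0 end.
2:{ unfold theta; rewrite Ha; simpl; ring. }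
rewrite Rplus_0_l; apply sum_n_congr; intros k Hk; unfold theta.
rewrite (minus_INR (S m) (S k)) by lia; ring.
Qed.

Lemma conv_ext_below (f g g' : nat -> R) (n : nat) :
  f 0%nat = 0 -> (forall k, (k < n)%nat -> g k = g' k) ->
  conv f g n = conv f g' n.
Proof.
intros Hf Hg; apply sum_n_congr; intros [|k] Hk.
- rewrite Hf; ring.
- rewrite Hg by lia; reflexivity.
Qed.

(** Since [a_0 = 0], the equation determines [n v_n] from the earlier terms. *)
Lemma rec_seq_unique (r : nat) (a v : nat -> R) :
  a 0%nat = 0 -> v 0%nat = 1 ->
  (forall n, theta v n = conv a (theta v) n + INR r * conv (theta a) v n) ->
  forall n, v n = rec_seq r a n.
Proof.
intros Ha Hv0 Hv n; induction n as [n IH] using lt_wf_ind.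
destruct n as [|m]; [now rewrite Hv0|].
apply Rmult_eq_reg_l with (INR (S m)); [|apply not_0_INR; lia].
change (theta v (S m) = theta (rec_seq r a) (S m)).
rewrite Hv, (rec_seq_ode r a) by assumption.
f_equal; [|f_equal]; apply conv_ext_below.
- exact Ha.
- intros k Hk; unfold theta; now rewrite IH.
- unfold theta; simpl; ring.
- exact IH.
Qed.

(** [(1 - A)^(-r) (1 - A)^(-r') = (1 - A)^(-(r + r'))]: by the product rule the
    left side solves the equation of the right side. *)
Lemma rec_seq_conv (r r' : nat) (a : nat -> R) (n : nat) :
  a 0%nat = 0 ->
  conv (rec_seq r a) (rec_seq r' a) n = rec_seq (r + r') a n.
Proof.
intros Ha; revert n; apply rec_seq_unique.
- exact Ha.
- rewrite conv_0, !rec_seq_0; ring.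
- intros n; set (u := rec_seq r a); set (v := rec_seq r' a).
  rewrite theta_conv.
  rewrite (conv_ext (theta u) (fun k => conv a (theta u) k + INR r * conv (theta a) u k) v v);
    [|intros k; now apply rec_seq_ode|reflexivity].
  rewrite (conv_ext u u (theta v) (fun k => conv a (theta v) k + INR r' * conv (theta a) v k));
    [|reflexivity|intros k; now apply rec_seq_ode].
  rewrite (conv_ext a a (theta (conv u v)) (fun k => conv (theta u) v k + conv u (theta v) k));
    [|reflexivity|intros k; apply theta_conv].
  rewrite conv_plus_l, !conv_plus_r, conv_scal_l, conv_scal_r, plus_INR.
  rewrite !conv_assoc.
  rewrite (conv_ext (conv u a) (conv a u) (theta v) (theta v));
    [|intros k; apply conv_comm|reflexivity].
  rewrite (conv_ext (conv u (theta a)) (conv (theta a) u) v v);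
    [|intros k; apply conv_comm|reflexivity].
  ring.
Qed.

Lemma rec_seq_scal (r : nat) (a : nat -> R) (z : R) (n : nat) :
  a 0%nat = 0 ->
  rec_seq r (fun k => a k * z ^ k) n = rec_seq r a n * z ^ n.
Proof.
intros Ha; symmetry; revert n; apply rec_seq_unique.
- rewrite Ha; ring.
- rewrite rec_seq_0; simpl; ring.
- intros n; set (u := rec_seq r a).
  assert (Hz : forall f g, conv (fun k => f k * z ^ k) (fun k => g k * z ^ k) n
                           = conv f g n * z ^ n).
  { intros f g; unfold conv.
    rewrite Rmult_comm, <- sum_n_scal; apply sum_n_congr; intros k Hk.
    replace (z ^ n) with (z ^ k * z ^ (n - k)) by (rewrite <- pow_add; f_equal; lia).
    ring. }
  assert (Ht : forall f k, theta (fun k => f k * z ^ k) k = theta f k * z ^ k)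
    by (intros f k; unfold theta; ring).
  rewrite Ht, (rec_seq_ode r a) by assumption.
  rewrite (conv_ext (fun k => a k * z ^ k) (fun k => a k * z ^ k)
    (theta (fun k => u k * z ^ k)) (fun k => theta u k * z ^ k));
    [|reflexivity|apply Ht].
  rewrite (conv_ext (theta (fun k => a k * z ^ k)) (fun k => theta a k * z ^ k)
    (fun k => u k * z ^ k) (fun k => u k * z ^ k)); [|apply Ht|reflexivity].
  rewrite !Hz; unfold u; ring.
Qed.

Lemma rec_seq_pos (r : nat) (a : nat -> R) (n : nat) :
  (1 <= r)%nat -> (forall k, 0 <= a k) -> 0 < a 1%nat -> 0 < rec_seq r a n.
Proof.
intros Hr Ha Ha1; induction n as [n IH] using lt_wf_ind.
destruct n as [|m]; [rewrite rec_seq_0; lra|].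
rewrite rec_seq_rec by lia.
apply le_INR in Hr; simpl in Hr.
assert (Hw : forall k, 0 < INR (S m) + (INR r - 1) * INR k).
{ intros k; pose proof (lt_0_INR (S m) ltac:(lia)); pose proof (pos_INR k).
  assert (0 <= (INR r - 1) * INR k) by (apply Rmult_le_pos; lra); lra. }
apply Rmult_lt_0_compat.
{ apply Rdiv_lt_0_compat; [lra|apply lt_0_INR; lia]. }
rewrite <- sum_n_m_S.
fold (sum_n (fun k => (INR (S m) + (INR r - 1) * INR (S k)) * a (S k)
                      * rec_seq r a (S m - S k)) m).
assert (Hterm : forall k, (k <= m)%nat ->
  0 <= (INR (S m) + (INR r - 1) * INR (S k)) * a (S k) * rec_seq r a (S m - S k)).
{ intros k Hk; apply Rmult_le_pos; [apply Rmult_le_pos|].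
  - apply Rlt_le, Hw.
  - apply Ha.
  - apply Rlt_le, IH; lia. }
assert (H0 : 0 < (INR (S m) + (INR r - 1) * INR 1) * a 1%nat * rec_seq r a (S m - 1)).
{ apply Rmult_lt_0_compat; [apply Rmult_lt_0_compat|]; auto; apply IH; lia. }
destruct m as [|m']; [now rewrite sum_O|].
rewrite sum_n_S_left; apply Rplus_lt_le_0_compat; [exact H0|].
apply sum_n_nonneg; intros k Hk; apply Hterm; lia.
Qed.

(** * Summation of the recursive sequence *)

Lemma is_series_conv (f g : nat -> R) (F G : R) :
  (forall k, 0 <= f k) -> (forall k, 0 <= g k) ->
  is_series f F -> is_series g G -> is_series (conv f g) (F * G).
Proof.
intros Hf Hg HF HG.
apply is_series_ext with (fun n => sum_f_R0 (fun k => f k * g (n - k)%nat) n).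
{ intros n; symmetry; apply sum_n_Reals. }
apply is_series_mult; try assumption.
- apply ex_series_ext with f; [|now exists F].
  intros n; now rewrite Rabs_pos_eq.
- apply ex_series_ext with g; [|now exists G].
  intros n; now rewrite Rabs_pos_eq.
Qed.

Lemma sum_n_conv_one (f : nat -> R) (n : nat) :
  sum_n f n = conv (fun _ => 1) f n.
Proof. rewrite conv_comm; apply sum_n_congr; intros k _; ring. Qed.

Lemma sum_n_incr (f : nat -> R) (m n : nat) :
  (forall k, 0 <= f k) -> (m <= n)%nat -> sum_n f m <= sum_n f n.
Proof.
intros Hf; induction 1 as [|n Hn IH]; [apply Rle_refl|].
rewrite sum_n_S_right; specialize (Hf (S n)); lra.
Qed.

Lemma sum_n_le_is_series (f : nat -> R) (F : R) (n : nat) :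
  (forall k, 0 <= f k) -> is_series f F -> sum_n f n <= F.
Proof.
intros Hf HF; apply (is_lim_seq_incr_compare (sum_n f) F HF).
intros k; apply sum_n_incr; [exact Hf|lia].
Qed.

Lemma rec_seq_1_conv (a : nat -> R) (n : nat) :
  a 0%nat = 0 -> rec_seq 1 a (S n) = conv a (rec_seq 1 a) (S n).
Proof.
intros Ha; apply Rmult_eq_reg_l with (INR (S n)); [|apply not_0_INR; lia].
change (theta (rec_seq 1 a) (S n) = theta (conv a (rec_seq 1 a)) (S n)).
rewrite theta_conv, rec_seq_ode by assumption; simpl; ring.
Qed.

(** The partial sums [U_n] of the renewal sequence satisfy
    [U_n <= 1 + A U_n], which bounds them because [A < 1]; the limit then
    solves [U = 1 + A U]. *)
Lemma is_series_rec_seq_1 (a : nat -> R) (A : R) :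
  a 0%nat = 0 -> (forall k, 0 <= a k) -> 0 < a 1%nat ->
  is_series a A -> A < 1 ->
  is_series (rec_seq 1 a) (1 / (1 - A)).
Proof.
intros Ha0 Ha Ha1 HA HA1; set (u := rec_seq 1 a).
assert (Hu : forall k, 0 <= u k)
  by (intros k; apply Rlt_le, rec_seq_pos; auto).
assert (Hsum : forall n, sum_n u (S n) = 1 + sum_n (conv a u) (S n)).
{ intros n; rewrite !sum_n_S_left; f_equal.
  rewrite conv_0, Ha0, Rmult_0_l, Rplus_0_l.
  apply sum_n_congr; intros k _; now apply rec_seq_1_conv. }
assert (Hbound : forall n, sum_n u n <= 1 / (1 - A)).
{ intros n; apply Rle_trans with (sum_n u (S n)); [apply sum_n_incr; auto|].
  enough (sum_n u (S n) <= 1 + A * sum_n u (S n)).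
  { apply Rmult_le_reg_r with (1 - A); [lra|].
    unfold Rdiv; rewrite Rmult_assoc, Rinv_l; lra. }
  rewrite Hsum at 1; apply Rplus_le_compat_l.
  (* The partial sums of [conv a u] are [conv a] of the partial sums of [u],
     by associativity with the constant sequence [1]. *)
  rewrite sum_n_conv_one, conv_assoc.
  rewrite (conv_ext _ (conv a (fun _ => 1)) u u);
    [|intros k; apply conv_comm|reflexivity].
  rewrite <- conv_assoc.
  rewrite (conv_ext a a _ (sum_n u));
    [|reflexivity|intros k; symmetry; apply sum_n_conv_one].
  apply Rle_trans with (sum_n (fun k => sum_n u (S n) * a k) (S n)).
  - apply sum_n_le; intros k Hk; rewrite Rmult_comm; apply Rmult_le_compat_r; [apply Ha|].
    apply sum_n_incr; [exact Hu|lia].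
  - rewrite sum_n_scal, Rmult_comm; apply Rmult_le_compat_r.
    + now apply sum_n_nonneg.
    + now apply sum_n_le_is_series. }
destruct (ex_finite_lim_seq_incr (sum_n u) (1 / (1 - A))) as [U HU].
{ intros n; apply sum_n_incr; auto. }
{ exact Hbound. }
assert (HUs : is_series u U) by exact HU.
enough (E : U = 1 + A * U)
  by (replace (1 / (1 - A)) with U; [exact HUs|field_simplify_eq; lra]).
pose proof (is_series_conv a u A U Ha Hu HA HUs) as Hc.
assert (H1 : is_lim_seq (fun n => sum_n u (S n)) U)
  by (apply (is_lim_seq_incr_1 (sum_n u)); exact HU).
assert (H2 : is_lim_seq (fun n => 1 + sum_n (conv a u) (S n)) (1 + A * U)).
{ apply (is_lim_seq_plus' (fun _ => 1)); [apply is_lim_seq_const|].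
  apply (is_lim_seq_incr_1 (sum_n (conv a u))); exact Hc. }
apply (is_lim_seq_ext _ _ _ Hsum) in H1.
apply is_lim_seq_unique in H1; apply is_lim_seq_unique in H2.
rewrite H1 in H2; now injection H2.
Qed.

Lemma is_series_rec_seq (r : nat) (a : nat -> R) (A : R) :
  (1 <= r)%nat -> a 0%nat = 0 -> (forall k, 0 <= a k) -> 0 < a 1%nat ->
  is_series a A -> A < 1 ->
  is_series (rec_seq r a) (1 / (1 - A) ^ r).
Proof.
intros Hr Ha0 Ha Ha1 HA HA1.
induction Hr as [|r Hr IH].
{ rewrite pow_1; now apply is_series_rec_seq_1. }
replace (1 / (1 - A) ^ S r) with (1 / (1 - A) * (1 / (1 - A) ^ r))
  by (simpl; field; split; [apply pow_nonzero|]; lra).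
apply is_series_ext with (conv (rec_seq 1 a) (rec_seq r a)).
{ intros n; now apply (rec_seq_conv 1 r). }
apply is_series_conv; try assumption.
- intros k; apply Rlt_le, rec_seq_pos; auto.
- intros k; apply Rlt_le, rec_seq_pos; auto.
- now apply is_series_rec_seq_1.
Qed.

(** * Weighted differences and the Euler transformation *)

(** [(1 - l T)^m x] for the shift [T]; [l = 1] gives the finite differences of
    complete monotonicity. *)
Fixpoint diff (l : R) (m : nat) (x : nat -> R) (k : nat) : R :=
  match m with
  | O => x k
  | S m' => diff l m' x k - l * diff l m' x (S k)
  end.

Lemma diff_ext (l : R) (m : nat) (x y : nat -> R) (k : nat) :
  (forall i, x i = y i) -> diff l m x k = diff l m y k.
Proof.
intros H; revert k; induction m as [|m IH]; intros k; simpl; [apply H|].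
now rewrite !IH.
Qed.

Lemma diff_sub (l c : R) (m : nat) (x y : nat -> R) (k : nat) :
  diff l m (fun i => x i - c * y i) k = diff l m x k - c * diff l m y k.
Proof.
revert k; induction m as [|m IH]; intros k; simpl; [reflexivity|].
rewrite !IH; ring.
Qed.

Lemma diff_scal (l c : R) (m : nat) (x : nat -> R) (k : nat) :
  diff l m (fun i => c * x i) k = c * diff l m x k.
Proof.
revert k; induction m as [|m IH]; intros k; simpl; [reflexivity|].
rewrite !IH; ring.
Qed.

Lemma diff_shift (l : R) (m : nat) (x : nat -> R) (k : nat) :
  diff l m (fun i => x (S i)) k = diff l m x (S k).
Proof.
revert k; induction m as [|m IH]; intros k; simpl; [reflexivity|].
now rewrite !IH.
Qed.

(** Geometric sequences are eigenvectors. *)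
Lemma diff_geom (l w y : R) (m k : nat) :
  diff l m (fun i => w * y ^ i) k = w * y ^ k * (1 - l * y) ^ m.
Proof.
revert k; induction m as [|m IH]; intros k; simpl; [ring|].
rewrite !IH; simpl; ring.
Qed.

Lemma diff_binomial (l : R) (m : nat) (x : nat -> R) (k : nat) :
  diff l m x k =
  sum_n (fun j => Binomial.C m j * (- l) ^ j * x (k + j)%nat) m.
Proof.
assert (C0 : forall n, Binomial.C n 0 = 1).
{ intros n; unfold Binomial.C; rewrite Nat.sub_0_r; simpl.
  field; apply INR_fact_neq_0. }
assert (Cn : forall n, Binomial.C n n = 1).
{ intros n; unfold Binomial.C; rewrite Nat.sub_diag; simpl.
  field; apply INR_fact_neq_0. }
revert k; induction m as [|m IH]; intros k.
{ rewrite sum_O, C0, Nat.add_0_r; simpl; ring. }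
simpl diff; rewrite !IH.
destruct m as [|m].
{ rewrite sum_n_S_left, !sum_O, !C0, Cn, Nat.add_0_r, Nat.add_1_r, Nat.add_0_r.
  simpl; ring. }
rewrite (sum_n_S_left _ m), (sum_n_S_left _ (S m)), !C0.
rewrite !sum_n_S_right, !Cn.
rewrite (sum_n_congr
  (fun j => Binomial.C (S (S m)) (S j) * (- l) ^ S j * x (k + S j)%nat)
  (fun j => Binomial.C (S m) (S j) * (- l) ^ S j * x (k + S j)%nat
     + (- l) * (Binomial.C (S m) j * (- l) ^ j * x (S k + j)%nat)) m).
2:{ intros j Hj; rewrite <- pascal by lia.
    replace (S k + j)%nat with (k + S j)%nat by lia; simpl; ring. }
rewrite sum_n_add, sum_n_scal.
replace (S k + S m)%nat with (k + S (S m))%nat by lia; simpl; ring.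
Qed.

Definition completely_monotone (x : nat -> R) : Prop :=
  forall m k, 0 <= diff 1 m x k.

Lemma completely_monotone_shift (x : nat -> R) :
  completely_monotone x -> completely_monotone (fun k => x (S k)).
Proof. intros H m k; rewrite diff_shift; apply H. Qed.

Lemma completely_monotone_diff (x : nat -> R) :
  completely_monotone x -> completely_monotone (fun k => x k - 1 * x (S k)).
Proof.
intros H m k; rewrite diff_sub, diff_shift; exact (H (S m) k).
Qed.

Definition alt (x : nat -> R) (k : nat) : R := (-1) ^ k * x k.

Lemma sum_n_alt_bounds (x : nat -> R) (n : nat) :
  completely_monotone x -> 0 <= sum_n (alt x) n <= x 0%nat.
Proof.
revert x; induction n as [|n IH]; intros x Hx.
{ rewrite sum_O; unfold alt; simpl; pose proof (Hx 0%nat 0%nat) as H; simpl in H; lra. }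
rewrite sum_n_S_left.
rewrite (sum_n_congr _ (fun k => (-1) * alt (fun k => x (S k)) k))
  by (intros k _; unfold alt; simpl; ring).
rewrite sum_n_scal.
destruct (IH _ (completely_monotone_shift x Hx)) as [H1 H2].
pose proof (Hx 1%nat 0%nat) as H; unfold alt at 1 3; simpl in *; lra.
Qed.

Lemma Series_alt_nonneg (x : nat -> R) :
  completely_monotone x -> ex_series (alt x) -> 0 <= Series (alt x).
Proof.
intros Hx Hs.
apply (is_lim_seq_le (fun _ => 0) (sum_n (alt x)) 0 (Series (alt x))).
- intros n; now apply sum_n_alt_bounds.
- apply is_lim_seq_const.
- exact (Series_correct _ Hs).
Qed.

Lemma is_series_alt_shift (x : nat -> R) (X : R) :
  is_series (alt x) X -> is_series (alt (fun k => x (S k))) (x 0%nat - X).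
Proof.
intros H.
apply is_series_ext with (fun k => opp (alt x (S k))).
{ intros k; unfold alt, opp; simpl; ring. }
replace (x 0%nat - X) with (opp (X - x 0%nat)) by (unfold opp; simpl; ring).
apply (is_series_opp (fun k => alt x (S k))), is_series_incr_1.
change (is_series (alt x) (X - x 0%nat + alt x 0)).
replace (X - x 0%nat + alt x 0) with X; [exact H|].
unfold alt; simpl; ring.
Qed.

Lemma is_series_alt_step (l : R) (x : nat -> R) (X : R) :
  is_series (alt x) X ->
  is_series (alt (fun k => x k - l * x (S k))) ((1 + l) * X - l * x 0%nat).
Proof.
intros H.
replace ((1 + l) * X - l * x 0%nat) with (plus X (scal (- l) (x 0%nat - X)))
  by (unfold plus, scal; simpl; unfold mult; simpl; ring).
apply is_series_ext with
  (fun k => plus (alt x k) (scal (- l) (alt (fun k => x (S k)) k))).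
{ intros k; unfold alt, plus, scal; simpl; unfold mult; simpl; ring. }
apply (is_series_plus (alt x) (fun k => scal (- l) (alt (fun k => x (S k)) k)));
  [exact H|].
now apply (is_series_scal (- l) (alt (fun k => x (S k)))), is_series_alt_shift.
Qed.

Lemma ex_series_alt_diff (l : R) (m : nat) (x : nat -> R) :
  ex_series (alt x) -> ex_series (alt (diff l m x)).
Proof.
intros Hx; induction m as [|m [X HX]]; [exact Hx|].
exists ((1 + l) * X - l * diff l m x 0).
exact (is_series_alt_step l (diff l m x) X HX).
Qed.

Lemma Series_alt_shift (x : nat -> R) :
  ex_series (alt x) ->
  Series (alt (fun k => x (S k))) = x 0%nat - Series (alt x).
Proof.
intros H; apply is_series_unique, is_series_alt_shift, Series_correct, H.
Qed.

Lemma Series_alt_step (l : R) (x : nat -> R) :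
  ex_series (alt x) ->
  Series (alt (fun k => x k - l * x (S k))) =
  (1 + l) * Series (alt x) - l * x 0%nat.
Proof.
intros H; apply is_series_unique, is_series_alt_step, Series_correct, H.
Qed.

(** Write [T] for the shift and [D = 1 - T]; then [1 - l T = D + (1 - l) T]
    with [|1 - l| <= 1], while [D] and [T] preserve complete monotonicity and
    the alternating sums of [D x] and [T x] add up to that of [x]. *)
Lemma Rabs_Series_alt_diff_le (l : R) (m : nat) (x : nat -> R) :
  0 <= l <= 2 -> completely_monotone x -> ex_series (alt x) ->
  Rabs (Series (alt (diff l m x))) <= Series (alt x).
Proof.
intros Hl; revert x; induction m as [|m IH]; intros x Hx Hs.
{ rewrite Rabs_pos_eq; [apply Rle_refl|now apply Series_alt_nonneg]. }
set (dx := fun k => x k - 1 * x (S k)); set (tx := fun k => x (S k)).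
assert (Hdx : ex_series (alt dx)) by exact (ex_series_alt_diff 1 1 x Hs).
assert (Htx : ex_series (alt tx))
  by (exists (x 0%nat - Series (alt x)); apply is_series_alt_shift, Series_correct, Hs).
assert (E : Series (alt (diff l (S m) x))
          = Series (alt (diff l m dx)) + (1 - l) * Series (alt (diff l m tx))).
{ rewrite <- Series_scal_l, <- Series_plus.
  - apply Series_ext; intros k; unfold alt, dx, tx; simpl diff.
    rewrite diff_sub, diff_shift; ring.
  - now apply ex_series_alt_diff.
  - now apply (ex_series_scal (1 - l) (alt (diff l m tx))), ex_series_alt_diff. }
rewrite E; apply Rle_trans with (1 := Rabs_triang _ _); rewrite Rabs_mult.
pose proof (IH dx (completely_monotone_diff x Hx) Hdx) as H1.
pose proof (IH tx (completely_monotone_shift x Hx) Htx) as H2.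
assert (H3 : Rabs (1 - l) <= 1) by (apply Rabs_le; lra).
pose proof (Rabs_pos (Series (alt (diff l m tx)))) as H4.
pose proof (Series_alt_step 1 x Hs) as H5; fold dx in H5.
pose proof (Series_alt_shift x Hs) as H6; fold tx in H6.
assert (Rabs (1 - l) * Rabs (Series (alt (diff l m tx)))
        <= 1 * Rabs (Series (alt (diff l m tx)))) by (now apply Rmult_le_compat_r).
lra.
Qed.

(** For the alternating sum [X] of [x], one step gives
    [X = l x_0 / (1 + l) + X' / (1 + l)], where [X'] is the alternating sum
    of [diff l 1 x]; iterate. *)
Lemma euler_transform (l : R) (x : nat -> R) :
  0 < l <= 2 -> completely_monotone x -> ex_series (alt x) ->
  is_series (fun n => l * diff l n x 0 / (1 + l) ^ S n) (Series (alt x)).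
Proof.
intros Hl Hx Hs; set (X := Series (alt x)).
assert (Hp : forall n, (1 + l) ^ n <> 0) by (intros n; apply pow_nonzero; lra).
assert (E : forall n, X - Series (alt (diff l (S n) x)) / (1 + l) ^ S n
            = sum_n (fun n => l * diff l n x 0 / (1 + l) ^ S n) n).
{ intros n; induction n as [|n IH].
  - rewrite sum_O; simpl diff.
    rewrite (Series_alt_step l x Hs); fold X; simpl; field; lra.
  - rewrite sum_n_S_right, <- IH.
    change (Series (alt (diff l (S (S n)) x))) with
      (Series (alt (fun k => diff l (S n) x k - l * diff l (S n) x (S k)))).
    rewrite (Series_alt_step l (diff l (S n) x)) by now apply ex_series_alt_diff.
    change ((1 + l) ^ S (S n)) with ((1 + l) * (1 + l) ^ S n).
    field; split; [apply Hp|lra]. }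
assert (Hlim : is_lim_seq (fun n => Series (alt (diff l (S n) x)) / (1 + l) ^ S n) 0).
{ apply is_lim_seq_abs_0.
  apply is_lim_seq_le_le with (fun _ => 0) (fun n => X * (/ (1 + l)) ^ S n).
  - intros n; split; [apply Rabs_pos|].
    unfold Rdiv; rewrite Rabs_mult, Rabs_inv, (Rabs_pos_eq ((1 + l) ^ S n))
      by (apply pow_le; lra).
    rewrite pow_inv; apply Rmult_le_compat_r.
    + apply Rlt_le, Rinv_0_lt_compat, pow_lt; lra.
    + apply Rabs_Series_alt_diff_le; [lra|assumption..].
  - apply is_lim_seq_const.
  - replace (Finite 0) with (Rbar_mult X 0) by (simpl; f_equal; ring).
    apply is_lim_seq_scal_l.
    apply (is_lim_seq_incr_1 (fun n => (/ (1 + l)) ^ n)), is_lim_seq_geom.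
    rewrite Rabs_pos_eq by (apply Rlt_le, Rinv_0_lt_compat; lra).
    rewrite <- Rinv_1; apply Rinv_lt_contravar; lra. }
apply (is_lim_seq_ext _ _ X E).
replace (Finite X) with (Finite (X - 0)) by (f_equal; ring).
apply is_lim_seq_minus'; [apply is_lim_seq_const|exact Hlim].
Qed.

(** * The reciprocal odd powers *)

Definition odd_power (s : R) (k : nat) : R := Rpower (2 * INR k + 3) (- s).

Lemma is_derive_diff (l : R) (m : nat) (x : R -> nat -> R) (x' : nat -> R)
    (t : R) (k : nat) :
  (forall i, is_derive (fun u => x u i) t (x' i)) ->
  is_derive (fun u => diff l m (x u) k) t (diff l m x' k).
Proof.
intros H; revert k; induction m as [|m IH]; intros k; simpl; [apply H|].
apply (is_derive_minus (fun u => diff l m (x u) k)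
         (fun u => l * diff l m (x u) (S k))); [apply IH|].
apply (is_derive_scal (fun u => diff l m (x u) (S k))), IH.
Qed.

Lemma is_derive_Rpower (s c t : R) :
  0 < t + c ->
  is_derive (fun u => Rpower (u + c) (- s)) t (- s * Rpower (t + c) (- (s + 1))).
Proof.
intros H; unfold Rpower; auto_derive; [lra|].
replace (- (s + 1) * ln (t + c)) with (- s * ln (t + c) + - ln (t + c)) by ring.
rewrite exp_plus, exp_Ropp, (exp_ln (t + c)) by lra; field; lra.
Qed.

(** The derivative in [t] of a difference of [t^(-s)] is [- s] times the same
    difference of [t^(-(s+1))], negative by induction on the order for all
    [s] at once; hence the difference decreases and the next one is
    positive. *)
Lemma diff_Rpower_pos (m : nat) (s t : R) :
  0 < s -> 0 < t ->
  0 < diff 1 m (fun j => Rpower (t + 2 * INR j) (- s)) 0.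
Proof.
revert s t; induction m as [|m IH]; intros s t Hs Ht; [apply exp_pos|].
set (f := fun t => diff 1 m (fun j => Rpower (t + 2 * INR j) (- s)) 0).
change (0 < f t - 1 * diff 1 m (fun j => Rpower (t + 2 * INR j) (- s)) 1).
rewrite <- diff_shift.
replace (diff 1 m (fun i => Rpower (t + 2 * INR (S i)) (- s)) 0) with (f (t + 2)).
2:{ apply diff_ext; intros j; f_equal; rewrite S_INR; ring. }
set (f' := fun t => diff 1 m (fun j => - s * Rpower (t + 2 * INR j) (- (s + 1))) 0).
assert (Hd : forall u, 0 < u -> is_derive f u (f' u)).
{ intros u Hu; unfold f, f'.
  apply (is_derive_diff 1 m (fun u j => Rpower (u + 2 * INR j) (- s))).
  intros j; apply is_derive_Rpower; pose proof (pos_INR j); lra. }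
destruct (MVT_gen f t (t + 2) f') as [c [Hc E]].
- intros x Hx; rewrite Rmin_left, Rmax_right in Hx by lra; apply Hd; lra.
- intros x Hx; rewrite Rmin_left, Rmax_right in Hx by lra.
  apply derivable_continuous_pt; exists (f' x); apply is_derive_Reals, Hd; lra.
- rewrite Rmin_left, Rmax_right in Hc by lra.
  unfold f' in E; rewrite diff_scal in E.
  pose proof (IH (s + 1) c ltac:(lra) ltac:(lra)) as Hp.
  pose proof (Rmult_lt_0_compat _ _ Hs Hp); lra.
Qed.

Lemma diff_at (l : R) (m : nat) (x : nat -> R) (k : nat) :
  diff l m x k = diff l m (fun j => x (k + j)%nat) 0.
Proof.
rewrite !diff_binomial; apply sum_n_congr; intros j _; reflexivity.
Qed.

Lemma diff_odd_power_pos (s : R) (m k : nat) :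
  0 < s -> 0 < diff 1 m (odd_power s) k.
Proof.
intros Hs; rewrite diff_at.
rewrite (diff_ext _ _ _ (fun j => Rpower (2 * INR k + 3 + 2 * INR j) (- s))).
- apply diff_Rpower_pos; [exact Hs|pose proof (pos_INR k); lra].
- intros j; unfold odd_power; f_equal; rewrite plus_INR; ring.
Qed.

Lemma completely_monotone_odd_power (s : R) :
  0 < s -> completely_monotone (odd_power s).
Proof. intros Hs m k; now apply Rlt_le, diff_odd_power_pos. Qed.

Lemma is_series_alt_odd_power (s : R) :
  0 < s -> is_series (alt (odd_power s)) (1 - beta s).
Proof.
intros Hs.
set (x := fun k => Rpower (2 * INR k + 1) (- s)).
assert (Hx : is_series (alt x) (beta s)).
{ apply is_series_ext with (beta_term s); [|now apply beta_correct].
  intros k; unfold alt, x, beta_term; now rewrite Rpower_Ropp. }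
apply is_series_alt_shift in Hx.
replace (x 0%nat) with 1 in Hx.
2:{ unfold x, Rpower; simpl; rewrite Rmult_0_r, Rplus_0_l, ln_1, Rmult_0_r.
    symmetry; apply exp_0. }
revert Hx; apply is_series_ext; intros k; unfold alt, x, odd_power.
do 2 f_equal; rewrite S_INR; ring.
Qed.

Lemma q_diff (s : R) (n : nat) : q s (S n) = diff 1 n (odd_power s) 0.
Proof.
rewrite diff_binomial; unfold q; rewrite <- sum_n_m_S.
apply sum_n_congr; intros j _; unfold odd_power.
rewrite Rpower_Ropp, !Nat.sub_succ, !Nat.sub_0_r, Nat.add_0_l, S_INR.
replace (2 * (INR j + 1) + 1) with (2 * INR j + 3) by ring.
rewrite pow_add; simpl; unfold Rdiv; replace (- (1)) with (-1) by ring; ring.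
Qed.

Lemma p_diff (s : R) (n : nat) : p s (S n) = 2 * diff 2 n (odd_power s) 0.
Proof.
rewrite diff_binomial; unfold p; rewrite <- sum_n_m_S, <- sum_n_scal.
apply sum_n_congr; intros j _; unfold odd_power.
rewrite Rpower_Ropp, !Nat.sub_succ, !Nat.sub_0_r, Nat.add_0_l, S_INR.
replace (2 * (INR j + 1) + 1) with (2 * INR j + 3) by ring.
replace (- (2)) with (-1 * 2) by ring.
rewrite pow_add, Rpow_mult_distr; simpl; unfold Rdiv; ring.
Qed.

(** * Analytic preliminaries *)

Lemma ln_le_sub_1 (z : R) : 0 < z -> ln z <= z - 1.
Proof.
intros Hz; pose proof (exp_ineq1_le (ln z)) as H.
rewrite exp_ln in H by exact Hz; lra.
Qed.

Lemma continuous_of_ex_derive (f : R -> R) (x : R) :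
  ex_derive f x -> continuous f x.
Proof. exact (ex_derive_continuous f x). Qed.

Lemma continuous_0_of_Rabs_le (f : R -> R) :
  f 0 = 0 -> (forall x, Rabs x < 1 -> Rabs (f x) <= Rabs x) -> continuous f 0.
Proof.
intros H0 H; apply continuity_pt_filterlim; intros eps He.
exists (Rmin 1 eps); split; [apply Rmin_pos; lra|].
intros x [_ Hx]; revert Hx; simpl; unfold Rdist; rewrite H0, !Rminus_0_r; intros Hx.
apply Rle_lt_trans with (Rabs x).
- apply H; apply Rlt_le_trans with (1 := Hx), Rmin_l.
- apply Rlt_le_trans with (1 := Hx), Rmin_r.
Qed.

Lemma continuous_diff (l : R) (m : nat) (x : R -> nat -> R) (t : R) (k : nat) :
  (forall i, continuous (fun u => x u i) t) ->
  continuous (fun u => diff l m (x u) k) t.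
Proof.
intros H; revert k; induction m as [|m IH]; intros k; simpl; [apply H|].
apply (continuous_minus (fun u => diff l m (x u) k)
         (fun u => l * diff l m (x u) (S k))); [apply IH|].
apply (continuous_scal_r l (fun u => diff l m (x u) (S k))), IH.
Qed.

Lemma is_RInt_diff (l a b : R) (m : nat) (x : R -> nat -> R) (y : nat -> R) (k : nat) :
  (forall i, is_RInt (fun u => x u i) a b (y i)) ->
  is_RInt (fun u => diff l m (x u) k) a b (diff l m y k).
Proof.
intros H; revert k; induction m as [|m IH]; intros k; simpl; [apply H|].
apply (is_RInt_minus (fun u => diff l m (x u) k)
         (fun u => l * diff l m (x u) (S k))); [apply IH|].
apply (is_RInt_scal (fun u => diff l m (x u) (S k))), IH.
Qed.

Lemma is_lim_seq_diff (l : R) (m : nat) (x : nat -> nat -> R) (y : nat -> R) (k : nat) :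
  (forall i, is_lim_seq (fun n => x n i) (y i)) ->
  is_lim_seq (fun n => diff l m (x n) k) (diff l m y k).
Proof.
intros H; revert k; induction m as [|m IH]; intros k; simpl; [apply H|].
apply is_lim_seq_minus'; [apply IH|].
exact (is_lim_seq_scal_l (fun n => diff l m (x n) (S k)) l _ (IH (S k))).
Qed.

(** * Signs of the weighted differences for exponent 2 *)

(** The function [- ln (1 - t) / t] increases on [(0, 1)]; compare its values at
    [A] and at [B = 1 - A]. *)
Lemma entropy_compare (A B : R) :
  0 < A -> A <= B -> A + B = 1 -> - (B * ln B) <= - (A * ln A).
Proof.
intros HA HAB HS.
set (f := fun t => - ln (1 - t) / t).
set (f' := fun t => (t / (1 - t) + ln (1 - t)) / t ^ 2).
assert (Hd : forall x, 0 < x < 1 -> is_derive f x (f' x)).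
{ intros x Hx; unfold f, f'; auto_derive; [lra|].
  change (1 + - x) with (1 - x); field; lra. }
destruct (MVT_gen f A B f') as [c [Hc E]].
1, 2: intros x Hx; rewrite Rmin_left, Rmax_right in Hx by lra.
- apply Hd; lra.
- apply derivable_continuous_pt; exists (f' x); apply is_derive_Reals, Hd; lra.
- rewrite Rmin_left, Rmax_right in Hc by lra.
  assert (Hf' : 0 <= f' c).
  { unfold f'; apply Rdiv_le_0_compat; [|apply pow_lt; lra].
    pose proof (ln_le_sub_1 (/ (1 - c)) ltac:(apply Rinv_0_lt_compat; lra)) as H.
    rewrite ln_Rinv in H by lra.
    replace (c / (1 - c)) with (/ (1 - c) - 1) by (field; lra); lra. }
  pose proof (Rmult_le_pos _ (B - A) Hf' ltac:(lra)) as H; rewrite <- E in H.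
  unfold f in H; replace (1 - B) with A in H by lra; replace (1 - A) with B in H by lra.
  apply Rmult_le_compat_l with (r := A * B) in H; [|apply Rmult_le_pos; lra].
  replace (A * B * (- ln A / B - - ln B / A)) with (- (A * ln A) + B * ln B) in H
    by (field; lra).
  lra.
Qed.

(** The previous inequality for the squares reads
    [- y^2 ln y <= - x^2 ln x]; dividing by [y] leaves the factor [x / y <= 1]
    on the right. *)
Lemma xlnx_compare (x y : R) :
  0 < x -> x <= y -> x ^ 2 + y ^ 2 = 1 -> - (y * ln y) <= - (x * ln x).
Proof.
intros Hx Hxy E.
assert (Hx2 : 0 < x ^ 2) by (apply pow_lt; lra).
assert (Hxy2 : x ^ 2 <= y ^ 2) by (apply pow_incr; lra).
pose proof (entropy_compare (x ^ 2) (y ^ 2) Hx2 Hxy2 E) as H.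
rewrite !ln_pow in H by lra; simpl in H.
assert (Hln : ln x <= 0).
{ rewrite <- ln_1; apply ln_le; [lra|]; nra. }
apply Rmult_le_reg_l with y; [lra|].
apply Rle_trans with (x * - (x * ln x)); [lra|].
apply Rmult_le_compat_r; [nra|lra].
Qed.

(** The antiderivative of [x^(2k+2) (- ln x)] that vanishes at [0]; an explicit
    formula replaces integrals that are improper at [0]. *)
Definition log_moment (k : nat) (x : R) : R :=
  x ^ (2 * k + 3) * (/ (2 * INR k + 3) ^ 2 - ln x / (2 * INR k + 3)).

Lemma is_derive_log_moment (k : nat) (x : R) :
  0 < x -> is_derive (log_moment k) x ((- x ^ 2 * ln x) * (x ^ 2) ^ k).
Proof.
intros Hx; unfold log_moment; pose proof (pos_INR k).
auto_derive; [lra|].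
replace (Init.Nat.pred (k + (k + 0) + 3)) with (2 + 2 * k)%nat by lia.
replace (k + (k + 0) + 3)%nat with (3 + 2 * k)%nat by lia.
rewrite !pow_add, pow_mult, plus_INR, mult_INR.
generalize ((x ^ 2) ^ k); intros z; simpl; field; lra.
Qed.

Lemma continuous_log_moment_0 (k : nat) : continuous (log_moment k) 0.
Proof.
set (L := fun x => x * x * ln x).
assert (HL : continuous L 0).
{ apply continuous_0_of_Rabs_le; unfold L; [ring|].
  intros x Hx; destruct (Rlt_dec 0 x) as [H|H].
  - rewrite Rabs_pos_eq in Hx by lra.
    assert (Hl : ln x <= 0) by (rewrite <- ln_1; apply ln_le; lra).
    pose proof (ln_le_sub_1 (/ x) ltac:(now apply Rinv_0_lt_compat)) as H1.
    rewrite ln_Rinv in H1 by exact H.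
    rewrite (Rabs_pos_eq x), Rabs_left1 by nra.
    apply Rmult_le_compat_l with (r := x * x) in H1; [|nra].
    replace (x * x * (/ x - 1)) with (x - x * x) in H1 by (field; lra); nra.
  - replace (ln x) with 0; [rewrite Rmult_0_r, Rabs_R0; apply Rabs_pos|].
    unfold ln; destruct (Rlt_dec 0 x); [contradiction|reflexivity]. }
apply continuous_ext with
  (fun x => x ^ (2 * k + 3) * / (2 * INR k + 3) ^ 2
            - x ^ (2 * k + 1) * / (2 * INR k + 3) * L x).
{ intros x; unfold log_moment, L; rewrite !pow_add; simpl; unfold Rdiv; ring. }
apply (continuous_minus (fun x => x ^ (2 * k + 3) * / (2 * INR k + 3) ^ 2)
         (fun x => x ^ (2 * k + 1) * / (2 * INR k + 3) * L x)).
- apply continuous_of_ex_derive; auto_derive; trivial.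
- apply (continuous_mult (fun x => x ^ (2 * k + 1) * / (2 * INR k + 3)) L);
    [|exact HL].
  apply continuous_of_ex_derive; auto_derive; trivial.
Qed.

Lemma log_moment_1 (k : nat) : log_moment k 1 = odd_power 2 k.
Proof.
unfold log_moment, odd_power; pose proof (pos_INR k).
rewrite pow1, ln_1, Rpower_Ropp.
replace 2 with (INR 2) at 4 by (simpl; ring).
rewrite Rpower_pow by lra; field; lra.
Qed.

(** Put [G' = x^2 (- ln x) (1 - 2 x^2)^m] and substitute [x = sin t] on
    [[0, pi/4]], [x = cos t] on the rest.  For odd [m] the two halves of the
    integral have opposite signs, and the first dominates pointwise by
    [xlnx_compare]; so [t |-> G (sin t) - G (cos t)] increases from [- G 1] to
    [0]. *)
Lemma diff_odd_power_2_nonneg (j : nat) :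
  0 <= diff 2 (S (2 * j)) (odd_power 2) 0.
Proof.
set (m := S (2 * j)).
set (G := fun x => diff 2 m (fun k => log_moment k x) 0).
set (G' := fun x => - x ^ 2 * ln x * (1 - 2 * x ^ 2) ^ m).
assert (HG : forall x, 0 < x -> is_derive G x (G' x)).
{ intros x Hx; unfold G, G'.
  replace (- x ^ 2 * ln x * (1 - 2 * x ^ 2) ^ m) with
    (diff 2 m (fun k => - x ^ 2 * ln x * (x ^ 2) ^ k) 0)
    by (rewrite diff_geom; simpl; ring).
  apply (is_derive_diff 2 m (fun x k => log_moment k x)).
  intros k; now apply is_derive_log_moment. }
assert (HGc : forall x, 0 <= x -> continuous G x).
{ intros x [Hx|<-].
  - apply continuous_of_ex_derive; exists (G' x); now apply HG.
  - apply (continuous_diff 2 m (fun x k => log_moment k x)).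
    intros k; apply continuous_log_moment_0. }
assert (HG1 : G 1 = diff 2 m (odd_power 2) 0)
  by (apply diff_ext; intros k; apply log_moment_1).
assert (HG0 : G 0 = 0).
{ unfold G; rewrite (diff_ext _ _ _ (fun k => 0 * odd_power 2 k)).
  - rewrite diff_scal; ring.
  - intros k; unfold log_moment; rewrite pow_i by lia; ring. }
set (H := fun t => G (sin t) - G (cos t)).
set (H' := fun t => G' (sin t) * cos t + G' (cos t) * sin t).
pose proof PI_RGT_0 as HPI.
assert (Hpos : forall t, 0 <= t <= PI / 4 -> 0 <= sin t /\ 0 < cos t).
{ intros t Ht; split; [apply sin_ge_0; lra|apply cos_gt_0; lra]. }
destruct (MVT_gen H 0 (PI / 4) H') as [c [Hc E]].
1, 2: intros t Ht; rewrite Rmin_left, Rmax_right in Ht by lra.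
- destruct (Hpos t ltac:(lra)) as [_ Hcos].
  assert (Hsin : 0 < sin t) by (apply sin_gt_0; lra).
  unfold H, H'.
  replace (G' (sin t) * cos t + G' (cos t) * sin t)
    with (minus (cos t * G' (sin t)) (- sin t * G' (cos t)))
    by (unfold minus, plus, opp; simpl; ring).
  apply (is_derive_minus (fun t => G (sin t)) (fun t => G (cos t))).
  + apply (is_derive_comp G sin); [now apply HG|apply is_derive_sin].
  + apply (is_derive_comp G cos); [now apply HG|apply is_derive_cos].
- destruct (Hpos t Ht) as [Hsin Hcos].
  apply continuity_pt_minus; apply continuity_pt_filterlim.
  + apply (continuous_comp sin G); [apply continuous_sin|now apply HGc].
  + apply (continuous_comp cos G); [apply continuous_cos|apply HGc; lra].
- rewrite Rmin_left, Rmax_right in Hc by lra.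
  unfold H at 1 2 in E; rewrite sin_PI4, cos_PI4, sin_0, cos_0, HG0, HG1 in E.
  enough (0 <= H' c).
  { pose proof (Rmult_le_pos (H' c) (PI / 4 - 0) ltac:(assumption) ltac:(lra)); lra. }
  destruct (Hpos c Hc) as [Hsin Hcos]; unfold H', G'.
  pose proof (sin2_cos2 c) as Hsc; unfold Rsqr in Hsc.
  pose proof (cos_2a_sin c) as Hd.
  assert (Hd0 : 0 <= cos (2 * c)) by (apply cos_ge_0; lra).
  set (x := sin c) in *; set (y := cos c) in *.
  replace (1 - 2 * x ^ 2) with (cos (2 * c)) by (rewrite Hd; ring).
  replace (1 - 2 * y ^ 2) with (- 1 * cos (2 * c)) by (rewrite Hd; nra).
  rewrite Rpow_mult_distr; unfold m; rewrite pow_1_odd.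
  set (P := cos (2 * c) ^ S (2 * j)).
  assert (HP : 0 <= P) by now apply pow_le.
  replace (- x ^ 2 * ln x * P * y + - y ^ 2 * ln y * (-1 * P) * x)
    with (x * y * P * (- (x * ln x) - - (y * ln y))) by ring.
  destruct Hsin as [Hsin|Hsin]; [|rewrite <- Hsin; lra].
  apply Rmult_le_pos; [apply Rmult_le_pos; [nra|exact HP]|].
  assert (x <= y) by nra.
  pose proof (xlnx_compare x y Hsin ltac:(assumption) ltac:(nra)); lra.
Qed.

(** * Larger exponents, by truncated Gamma integrals *)

Lemma exp_le_exp (x y : R) : x <= y -> exp x <= exp y.
Proof.
intros [H | ->]; [now apply Rlt_le, exp_increasing|apply Rle_refl].
Qed.

(** This is [v^(s-1)] on the half-line.  Since [ln 0 = 0] makes [Rpower 0 x]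
    equal to [1], the factor [v] is split off to get continuity at [0] and
    hence ordinary integrals over [[0, b]]. *)
Definition gamma_weight (s v : R) : R := v * Rpower v (s - 2).

Definition gamma_trunc (s b : R) : R :=
  RInt (fun v => exp (- v) * gamma_weight s v) 0 b.

Lemma continuous_gamma_weight (s v : R) :
  2 <= s -> 0 <= v -> continuous (gamma_weight s) v.
Proof.
intros Hs [Hv|<-].
{ apply continuous_of_ex_derive; unfold gamma_weight, Rpower; auto_derive; lra. }
apply continuous_0_of_Rabs_le; unfold gamma_weight; [ring|].
intros x Hx; rewrite Rabs_mult; apply Rle_trans with (Rabs x * 1); [|lra].
apply Rmult_le_compat_l; [apply Rabs_pos|].
rewrite Rabs_pos_eq by apply Rlt_le, exp_pos.
rewrite <- exp_0; unfold Rpower; apply exp_le_exp.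
assert (ln x <= 0).
{ destruct (Rlt_dec 0 x) as [H|H].
  - rewrite Rabs_pos_eq in Hx by lra; rewrite <- ln_1; apply ln_le; lra.
  - unfold ln; destruct (Rlt_dec 0 x); [contradiction|lra]. }
nra.
Qed.

Lemma ex_RInt_gamma (s a b : R) :
  2 <= s -> 0 <= a -> 0 <= b ->
  ex_RInt (fun v => exp (- v) * gamma_weight s v) a b.
Proof.
intros Hs Ha Hb; apply (ex_RInt_continuous (V := R_CompleteNormedModule)).
intros v [Hv _].
apply (continuous_mult (fun v => exp (- v)) (gamma_weight s)).
- apply continuous_of_ex_derive; auto_derive; trivial.
- apply continuous_gamma_weight; [exact Hs|].
  apply Rle_trans with (2 := Hv); now apply Rmin_glb.
Qed.

Lemma gamma_weight_pos (s v : R) : 0 < v -> 0 < gamma_weight s v.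
Proof. intros Hv; apply Rmult_lt_0_compat; [exact Hv|apply exp_pos]. Qed.

(** Tangent line bound for [ln] at [2 (s - 1)]: it gives
    [v^(s-1) <= K e^(v/2)] with [K] the exponential below, and [e^(-v/2)] has
    integral at most [2]. *)
Lemma gamma_trunc_bound (s b : R) :
  2 <= s -> 0 <= b ->
  gamma_trunc s b <= 2 * exp ((s - 1) * (ln (2 * (s - 1)) - 1)).
Proof.
intros Hs Hb; set (K := exp _).
assert (HI : is_RInt (fun v => K * exp (- v / 2)) 0 b
               (-2 * K * exp (- b / 2) - -2 * K * exp (- 0 / 2))).
{ apply (is_RInt_derive (V := R_CompleteNormedModule)
           (fun v => -2 * K * exp (- v / 2)) (fun v => K * exp (- v / 2))).
  - intros x _; auto_derive; [trivial|unfold Rdiv; field].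
  - intros x _; apply continuous_of_ex_derive; auto_derive; trivial. }
apply Rle_trans with (-2 * K * exp (- b / 2) - -2 * K * exp (- 0 / 2)).
- apply (is_RInt_le (fun v => exp (- v) * gamma_weight s v)
                    (fun v => K * exp (- v / 2)) 0 b).
  + exact Hb.
  + apply (RInt_correct (V := R_CompleteNormedModule)).
    apply ex_RInt_gamma; lra.
  + exact HI.
  + intros v [Hv _]; unfold gamma_weight, K, Rpower.
    rewrite <- (exp_ln v) at 2 by exact Hv.
    rewrite <- !exp_plus; apply exp_le_exp.
    pose proof (ln_le_sub_1 (v / (2 * (s - 1))) ltac:(apply Rdiv_lt_0_compat; lra)) as H.
    rewrite ln_div in H by lra.
    apply Rmult_le_compat_l with (r := s - 1) in H; [|lra].
    replace ((s - 1) * (v / (2 * (s - 1)) - 1)) with (v / 2 - (s - 1)) in H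
      by (field; lra).
    lra.
- replace (- 0 / 2) with 0 by lra; rewrite exp_0.
  pose proof (exp_pos (- b / 2)) as H1.
  pose proof (exp_pos ((s - 1) * (ln (2 * (s - 1)) - 1))) as H2.
  fold K in H2; pose proof (Rmult_lt_0_compat _ _ H2 H1); lra.
Qed.

Lemma gamma_trunc_lim (s : R) :
  2 <= s ->
  exists Gam, 0 < Gam /\ is_lim_seq (fun n => gamma_trunc s (INR n)) Gam.
Proof.
intros Hs.
assert (Hincr : forall n, gamma_trunc s (INR n) <= gamma_trunc s (INR (S n))).
{ intros n; pose proof (pos_INR n) as Hn; unfold gamma_trunc; rewrite S_INR.
  rewrite <- (RInt_Chasles (V := R_CompleteNormedModule) _ 0 (INR n) (INR n + 1))
    by (apply ex_RInt_gamma; lra).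
  change plus with Rplus.
  rewrite <- (Rplus_0_r (RInt _ 0 (INR n))) at 1; apply Rplus_le_compat_l.
  apply RInt_ge_0; [lra|apply ex_RInt_gamma; lra|].
  intros v Hv; apply Rmult_le_pos; [apply Rlt_le, exp_pos|].
  apply Rlt_le, gamma_weight_pos; lra. }
destruct (ex_finite_lim_seq_incr (fun n => gamma_trunc s (INR n))
  (2 * exp ((s - 1) * (ln (2 * (s - 1)) - 1)))) as [Gam HG].
- exact Hincr.
- intros n; apply gamma_trunc_bound; [exact Hs|apply pos_INR].
- exists Gam; split; [|exact HG].
  apply Rlt_le_trans with (gamma_trunc s (INR 1)).
  + apply RInt_gt_0; simpl; [lra| |].
    * intros v Hv; apply Rmult_lt_0_compat; [apply exp_pos|].
      apply gamma_weight_pos; lra.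
    * intros v Hv.
      apply (continuous_mult (fun v => exp (- v)) (gamma_weight s)).
      -- apply continuous_of_ex_derive; auto_derive; trivial.
      -- apply continuous_gamma_weight; lra.
  + exact (is_lim_seq_incr_compare _ _ HG Hincr 1%nat).
Qed.

(** Substituting [t v] for [v] turns powers of [t] into integrals.  The exact
    truncation [t b] is kept: after the limit only [Gamma(s)] remains. *)
Lemma is_RInt_gamma_scal (s t b : R) :
  2 <= s -> 0 < t -> 0 <= b ->
  is_RInt (fun v => exp (- (t * v)) * gamma_weight s v) 0 b
    (Rpower t (- s) * gamma_trunc s (t * b)).
Proof.
intros Hs Ht Hb.
apply is_RInt_ext with (fun v => scal (Rpower t (- s))
  (scal t (exp (- (t * v + 0)) * gamma_weight s (t * v + 0)))).
- intros v; rewrite Rmin_left, Rmax_right by lra; intros Hv.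
  unfold scal; simpl; unfold mult; simpl; rewrite Rplus_0_r.
  unfold gamma_weight; rewrite <- Rpower_mult_distr by lra.
  replace (Rpower t (- s)) with (/ (t * t * Rpower t (s - 2))).
  + field; split; [|lra].
    apply Rgt_not_eq, exp_pos.
  + rewrite Rpower_Ropp; f_equal.
    rewrite <- (Rpower_1 t) at 1 2 by exact Ht.
    rewrite <- !Rpower_plus; f_equal; ring.
- apply (is_RInt_scal (V := R_NormedModule)).
  apply (is_RInt_comp_lin (V := R_NormedModule)
    (fun v => exp (- v) * gamma_weight s v) t 0 0 b).
  rewrite Rmult_0_r, !Rplus_0_r.
  apply (RInt_correct (V := R_CompleteNormedModule)), ex_RInt_gamma; [exact Hs|lra|].
  apply Rmult_le_pos; lra.
Qed.

(** Under the integral sign the weighted difference acts on a geometric sequence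
    of ratio [e^(-2v)]. *)
Lemma is_RInt_gamma_diff (s : R) (m n : nat) :
  2 <= s ->
  is_RInt (fun v => exp (- (3 * v)) * gamma_weight s v
                    * (1 - 2 * exp (- (2 * v))) ^ m) 0 (INR n)
    (diff 2 m (fun k => odd_power s k * gamma_trunc s ((2 * INR k + 3) * INR n)) 0).
Proof.
intros Hs.
apply is_RInt_ext with (fun v => diff 2 m
  (fun k => exp (- ((2 * INR k + 3) * v)) * gamma_weight s v) 0).
- intros v _.
  rewrite (diff_ext _ _ _ (fun k => exp (- (3 * v)) * gamma_weight s v
                                    * (exp (- (2 * v))) ^ k)).
  + rewrite diff_geom; simpl; ring.
  + intros k.
    assert (E : (exp (- (2 * v))) ^ k = exp (- (2 * INR k * v))).
    { induction k as [|k IH]; [simpl; rewrite Rmult_0_r, Rmult_0_l, Ropp_0, exp_0; ring|].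
      rewrite S_INR; simpl; rewrite IH, <- exp_plus; f_equal; ring. }
    rewrite E, (Rmult_comm _ (gamma_weight s v)), (Rmult_comm _ (gamma_weight s v)).
    rewrite Rmult_assoc, <- exp_plus; do 2 f_equal; ring.
- apply (is_RInt_diff 2 0 (INR n) m
    (fun v k => exp (- ((2 * INR k + 3) * v)) * gamma_weight s v)).
  intros k; pose proof (pos_INR k).
  apply is_RInt_gamma_scal; [exact Hs|lra|apply pos_INR].
Qed.

(** The truncation bounds [(2k+3) n] are integers, so each term runs through a
    subsequence of [gamma_trunc s n] and all of them share its limit. *)
Lemma is_lim_seq_gamma_diff (s Gam : R) (m : nat) :
  is_lim_seq (fun n => gamma_trunc s (INR n)) Gam ->
  is_lim_seq (fun n => diff 2 m (fun k =>
      odd_power s k * gamma_trunc s ((2 * INR k + 3) * INR n)) 0)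
    (Gam * diff 2 m (odd_power s) 0).
Proof.
intros HG; rewrite <- diff_scal.
apply (is_lim_seq_diff 2 m
  (fun n k => odd_power s k * gamma_trunc s ((2 * INR k + 3) * INR n))).
intros k.
replace (Finite (Gam * odd_power s k)) with (Rbar_mult (odd_power s k) Gam)
  by (simpl; f_equal; ring).
apply (is_lim_seq_scal_l _ (odd_power s k) Gam).
apply is_lim_seq_ext with (fun n => gamma_trunc s (INR ((2 * k + 3) * n))).
{ intros n; rewrite mult_INR, plus_INR, mult_INR; do 3 f_equal; simpl; ring. }
apply (is_lim_seq_subseq (fun n => gamma_trunc s (INR n)) _ (fun n => ((2 * k + 3) * n)%nat)).
- apply eventually_subseq; intros n; lia.
- exact HG.
Qed.

(** [Gam] and [Gam2] stand for [Gamma(s)] and [Gamma(2)]: by the hypothesis, the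
    integrand for [s] is pointwise at least [w] times the integrand for [2]. *)
Lemma diff_odd_power_compare (s w : R) (m : nat) :
  2 <= s ->
  (forall v, 0 < v ->
     0 <= (1 - 2 * exp (- (2 * v))) ^ m * (Rpower v (s - 2) - w)) ->
  exists Gam Gam2, 0 < Gam /\ 0 < Gam2 /\
    w * (Gam2 * diff 2 m (odd_power 2) 0) <= Gam * diff 2 m (odd_power s) 0.
Proof.
intros Hs Hw.
destruct (gamma_trunc_lim s Hs) as [Gam [HGpos HG]].
destruct (gamma_trunc_lim 2 ltac:(lra)) as [Gam2 [HG2pos HG2]].
exists Gam, Gam2; do 2 (split; [assumption|]).
pose proof (is_lim_seq_gamma_diff s Gam m HG) as L.
pose proof (is_lim_seq_scal_l _ w _ (is_lim_seq_gamma_diff 2 Gam2 m HG2)) as L2.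
apply (is_lim_seq_le _ _ _ _) with (2 := L2) (3 := L).
intros n.
apply (is_RInt_le
  (fun v => w * (exp (- (3 * v)) * gamma_weight 2 v * (1 - 2 * exp (- (2 * v))) ^ m))
  (fun v => exp (- (3 * v)) * gamma_weight s v * (1 - 2 * exp (- (2 * v))) ^ m)
  0 (INR n)).
- apply pos_INR.
- apply (is_RInt_scal (V := R_NormedModule)), is_RInt_gamma_diff; lra.
- now apply is_RInt_gamma_diff.
- intros v [Hv _].
  pose proof (Hw v Hv) as H.
  pose proof (Rmult_lt_0_compat _ _ (exp_pos (- (3 * v))) Hv) as H1.
  apply Rmult_le_compat_l with (r := exp (- (3 * v)) * v) in H; [|lra].
  unfold gamma_weight.
  replace (Rpower v (2 - 2)) with 1
    by (rewrite Rminus_diag, Rpower_O by exact Hv; reflexivity).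
  lra.
Qed.

Lemma diff_odd_power_nonneg (s : R) (m : nat) :
  2 <= s -> 0 <= diff 2 m (odd_power s) 0.
Proof.
intros Hs.
enough (exists Gam, 0 < Gam /\ 0 <= Gam * diff 2 m (odd_power s) 0) as [Gam [H1 H2]].
{ apply Rmult_le_reg_l with Gam; [exact H1|now rewrite Rmult_0_r]. }
destruct (Nat.Even_or_Odd m) as [[j ->]|[j Hm]].
- (* An even power is nonnegative, so comparison with [0] is enough. *)
  destruct (diff_odd_power_compare s 0 (2 * j) Hs) as [Gam [Gam2 [H1 [H2 H]]]].
  { intros v Hv; rewrite pow_mult; apply Rmult_le_pos.
    - apply pow_le, pow2_ge_0.
    - pose proof (exp_pos ((s - 2) * ln v)); unfold Rpower; lra. }
  exists Gam; split; [exact H1|lra].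
- replace m with (S (2 * j)) by lia.
  (* [1 - 2 e^(-2v)] and [v^(s-2) - w] both change sign at [v = (ln 2)/2]. *)
  set (w := Rpower (ln 2 / 2) (s - 2)).
  assert (Hln2 : 0 < ln 2 / 2) by (pose proof ln_lt_2; lra).
  destruct (diff_odd_power_compare s w (S (2 * j)) Hs) as [Gam [Gam2 [H1 [H2 H]]]].
  { intros v Hv.
    replace ((1 - 2 * exp (- (2 * v))) ^ S (2 * j) * (Rpower v (s - 2) - w))
      with (((1 - 2 * exp (- (2 * v))) ^ 2) ^ j *
            ((1 - 2 * exp (- (2 * v))) * (Rpower v (s - 2) - w)))
      by (rewrite <- pow_mult, <- tech_pow_Rmult; ring).
    apply Rmult_le_pos; [apply pow_le, pow2_ge_0|].
    assert (E : exp (- (2 * (ln 2 / 2))) = / 2).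
    { rewrite exp_Ropp; replace (2 * (ln 2 / 2)) with (ln 2) by lra.
      rewrite exp_ln; lra. }
    destruct (Rle_lt_dec (ln 2 / 2) v) as [Hle|Hlt].
    - assert (exp (- (2 * v)) <= / 2) by (rewrite <- E; apply exp_le_exp; lra).
      assert (w <= Rpower v (s - 2)) by (apply Rle_Rpower_l; lra).
      apply Rmult_le_pos; lra.
    - assert (/ 2 <= exp (- (2 * v))) by (rewrite <- E; apply exp_le_exp; lra).
      assert (Rpower v (s - 2) <= w) by (apply Rle_Rpower_l; lra).
      nra. }
  exists Gam; split; [exact H1|].
  apply Rle_trans with (2 := H).
  apply Rmult_le_pos; [apply Rlt_le, exp_pos|].
  apply Rmult_le_pos; [lra|apply diff_odd_power_2_nonneg].
Qed.

(** * Rationality *)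

Lemma is_rational_IZR (z : Z) : is_rational (IZR z).
Proof.
exists (inject_Z z); unfold Q2R; simpl; field.
Qed.

Lemma is_rational_INR (n : nat) : is_rational (INR n).
Proof. rewrite INR_IZR_INZ; apply is_rational_IZR. Qed.

Lemma is_rational_plus (x y : R) :
  is_rational x -> is_rational y -> is_rational (x + y).
Proof. intros [a ->] [a' ->]; exists (a + a')%Q; now rewrite Q2R_plus. Qed.

Lemma is_rational_minus (x y : R) :
  is_rational x -> is_rational y -> is_rational (x - y).
Proof. intros [a ->] [a' ->]; exists (a - a')%Q; now rewrite Q2R_minus. Qed.

Lemma is_rational_mult (x y : R) :
  is_rational x -> is_rational y -> is_rational (x * y).
Proof. intros [a ->] [a' ->]; exists (a * a')%Q; now rewrite Q2R_mult. Qed.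

Lemma is_rational_inv (x : R) : x <> 0 -> is_rational x -> is_rational (/ x).
Proof.
intros Hx [a ->]; exists (/ a)%Q; rewrite Q2R_inv; [reflexivity|].
intros Ha; apply Hx; rewrite (Qeq_eqR _ _ Ha); apply RMicromega.Q2R_0.
Qed.

Lemma is_rational_pow (x : R) (n : nat) : is_rational x -> is_rational (x ^ n).
Proof.
intros Hx; induction n as [|n IH]; [apply (is_rational_IZR 1)|].
now apply is_rational_mult.
Qed.

Lemma is_rational_sum_n_m (f : nat -> R) (m n : nat) :
  (forall k, (m <= k <= n)%nat -> is_rational (f k)) -> is_rational (sum_n_m f m n).
Proof.
induction n as [|n IH]; intros H.
- destruct m as [|m]; [rewrite sum_n_n; apply H; lia|].
  rewrite sum_n_m_zero by lia; apply (is_rational_IZR 0).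
- destruct (le_lt_dec m (S n)) as [Hm|Hm].
  + rewrite sum_n_Sm by lia; apply is_rational_plus; [|apply H; lia].
    apply IH; intros k Hk; apply H; lia.
  + rewrite sum_n_m_zero by lia; apply (is_rational_IZR 0).
Qed.

Lemma is_rational_rec_seq (r : nat) (a : nat -> R) (n : nat) :
  (forall k, is_rational (a k)) -> is_rational (rec_seq r a n).
Proof.
intros Ha; induction n as [n IH] using lt_wf_ind.
destruct n as [|m]; [apply (is_rational_IZR 1)|].
rewrite rec_seq_rec by lia; unfold Rdiv; rewrite Rmult_1_l.
apply is_rational_mult.
{ apply is_rational_inv; [apply not_0_INR; lia|apply is_rational_INR]. }
apply is_rational_sum_n_m; intros k Hk.
apply is_rational_mult; [apply is_rational_mult|apply IH; lia]; [|apply Ha].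
apply is_rational_plus; [apply is_rational_INR|].
apply is_rational_mult; [|apply is_rational_INR].
apply is_rational_minus; [apply is_rational_INR|apply (is_rational_IZR 1)].
Qed.

Lemma is_rational_diff (l : R) (m : nat) (x : nat -> R) (k : nat) :
  is_rational l -> (forall i, is_rational (x i)) -> is_rational (diff l m x k).
Proof.
intros Hl Hx; revert k; induction m as [|m IH]; intros k; simpl; [apply Hx|].
now apply is_rational_minus; [|apply is_rational_mult].
Qed.

Lemma is_rational_odd_power (s : R) (k : nat) :
  0 < s -> is_integer s -> is_rational (odd_power s k).
Proof.
intros Hs [z ->]; apply lt_IZR in Hs.
unfold odd_power; pose proof (pos_INR k).
rewrite Rpower_Ropp, <- (Z2Nat.id z) by lia; rewrite <- INR_IZR_INZ.
rewrite Rpower_pow by lra.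
apply is_rational_inv; [apply pow_nonzero; lra|].
apply is_rational_pow, is_rational_plus; [|apply (is_rational_IZR 3)].
apply is_rational_mult; [apply (is_rational_IZR 2)|apply is_rational_INR].
Qed.

(** * Powers of the reciprocal of beta *)

(** The common form of both expansions: [a] is scaled by powers of [1/(1+l)],
    after which its sum is [1 - beta(s)] by the Euler transformation. *)
Lemma is_series_inv_beta_pow (l s : R) (r : nat) (a : nat -> R) :
  (1 <= r)%nat -> 0 < l <= 2 -> 0 < s ->
  a 0%nat = 0 ->
  (forall n, a (S n) = l * diff l n (odd_power s) 0) ->
  (forall k, 0 <= a k) -> 0 < a 1%nat ->
  is_series (fun n => rec_seq r a n / (1 + l) ^ n) (1 / beta s ^ r).
Proof.
intros Hr Hl Hs Ha0 HaS Ha Ha1; set (z := / (1 + l)).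
assert (Hz : 0 < z) by (apply Rinv_0_lt_compat; lra).
apply is_series_ext with (rec_seq r (fun k => a k * z ^ k)).
{ intros n; rewrite rec_seq_scal by exact Ha0.
  unfold z; rewrite pow_inv; reflexivity. }
replace (beta s) with (1 - (1 - beta s)) by ring.
apply is_series_rec_seq.
- exact Hr.
- rewrite Ha0; ring.
- intros k; apply Rmult_le_pos; [apply Ha|apply pow_le; lra].
- apply Rmult_lt_0_compat; [exact Ha1|apply pow_lt; lra].
- apply is_series_decr_1.
  change (is_series (fun k => a (S k) * z ^ S k) (1 - beta s + - (a 0%nat * z ^ 0))).
  rewrite Ha0, Rmult_0_l, Ropp_0, Rplus_0_r.
  pose proof (is_series_alt_odd_power s Hs) as Hsum.
  rewrite <- (is_series_unique _ _ Hsum).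
  eapply is_series_ext; [|apply (euler_transform l (odd_power s) Hl)].
  + intros n; cbv beta; rewrite HaS; unfold z; rewrite pow_inv; reflexivity.
  + now apply completely_monotone_odd_power.
  + now exists (1 - beta s).
- pose proof (beta_pos s Hs); lra.
Qed.

Lemma q_nonneg (s : R) (n : nat) : 0 < s -> 0 <= q s n.
Proof.
intros Hs; destruct n as [|n].
- unfold q; rewrite sum_n_m_zero by lia; apply Rle_refl.
- rewrite q_diff; now apply Rlt_le, diff_odd_power_pos.
Qed.

Lemma p_nonneg (s : R) (n : nat) : 2 <= s -> 0 <= p s n.
Proof.
intros Hs; destruct n as [|n].
- unfold p; rewrite sum_n_m_zero by lia; apply Rle_refl.
- rewrite p_diff; pose proof (diff_odd_power_nonneg s n Hs); lra.
Qed.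

Lemma q_1_pos (s : R) : 0 < q s 1.
Proof. rewrite q_diff; apply exp_pos. Qed.

Lemma p_1_pos (s : R) : 0 < p s 1.
Proof. rewrite p_diff; apply Rmult_lt_0_compat; [lra|apply exp_pos]. Qed.

Lemma is_rational_q (s : R) (n : nat) :
  0 < s -> is_integer s -> is_rational (q s n).
Proof.
intros Hs Hz; destruct n as [|n].
- unfold q; rewrite sum_n_m_zero by lia; apply (is_rational_IZR 0).
- rewrite q_diff; apply is_rational_diff; [apply (is_rational_IZR 1)|].
  intros i; now apply is_rational_odd_power.
Qed.

Lemma is_rational_p (s : R) (n : nat) :
  0 < s -> is_integer s -> is_rational (p s n).
Proof.
intros Hs Hz; destruct n as [|n].
- unfold p; rewrite sum_n_m_zero by lia; apply (is_rational_IZR 0).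
- rewrite p_diff; apply is_rational_mult; [apply (is_rational_IZR 2)|].
  apply is_rational_diff; [apply (is_rational_IZR 2)|].
  intros i; now apply is_rational_odd_power.
Qed.

Theorem theorem4p5 (r : nat) (hr : (1 <= r)%nat) :
  (forall s : R, 0 < s ->
     is_series (fun n : nat => b s r n / 2 ^ n) (1 / beta s ^ r)) /\
  (forall s : R, 2 <= s ->
     is_series (fun n : nat => c s r n / 3 ^ n) (1 / beta s ^ r)) /\
  (forall s : R, 0 < s -> forall n : nat, 0 < b s r n) /\
  (forall s : R, 2 <= s -> forall n : nat, 0 < c s r n) /\
  (forall s : R, 0 < s -> is_integer s ->
     forall n : nat, is_rational (b s r n)) /\
  (forall s : R, 2 <= s -> is_integer s ->
     forall n : nat, is_rational (c s r n)).
Proof.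
split; [|split; [|split; [|split; [|split]]]]; intros s Hs.
- replace 2 with (1 + 1) by ring.
  apply is_series_inv_beta_pow; try lra; try assumption.
  + unfold q; now rewrite sum_n_m_zero by lia.
  + intros n; rewrite q_diff; ring.
  + intros k; now apply q_nonneg.
  + apply q_1_pos.
- replace 3 with (1 + 2) by ring.
  apply is_series_inv_beta_pow; try lra; try assumption.
  + unfold p; now rewrite sum_n_m_zero by lia.
  + apply p_diff.
  + intros k; now apply p_nonneg.
  + apply p_1_pos.
- intros n; apply rec_seq_pos; [exact hr| |apply q_1_pos].
  intros k; now apply q_nonneg.
- intros n; apply rec_seq_pos; [exact hr| |apply p_1_pos].
  intros k; now apply p_nonneg.
- intros Hz n; apply is_rational_rec_seq; intros k; now apply is_rational_q.
- intros Hz n; apply is_rational_rec_seq; intros k.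
  apply is_rational_p; [lra|exact Hz].
Qed.
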